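(* For $p,q\in\mathbb{N}$ with $1\le q<p$ define \[ N(p,q)=\sum_{j\vdash q-1}\ \sum_{k\vdash p-q}\left(\prod_{i=1}^{q-1} j_i!\,i^{j_i}\prod_{i=1}^{p-q}k_i!\,i^{k_i}\right)^{-1}\prod_{a,b=1}^{p-q}\Bigl(1+\sum_{d\mid \operatorname{lcm}(a,b)} d\,j_d\Bigr)^{k_ak_b\gcd(a,b)}. \] Then for every $n\in\mathbb{N}$, the number of nilpotent semigroups of degree $3$ of order $n$ up to isomorphism equals \[ \sum_{m=2}^{a(n)}\bigl(N(n,m)-N(n-1,m-1)\bigr),\qquad a(n)=\left\lfloor n+\tfrac12-\sqrt{n-\tfrac34}\,\right\rfloor. \]
   Context: A semigroup $S$ is nilpotent of degree $3$ if, writing $S^r=\{s_1\cdots s_r: s_i\in S\}$, we have $|S^3|=1$ and $|S^2|>1$. For $n\ge 0$, $j\vdash n$ means $j$ is a partition of $n$ (the empty partition if $n=0$), and $j_i$ denotes the number of parts of $j$ equal to $i$ (so $j_i=0$ for $i>n$). Sums over $d\mid t$ range over positive divisors $d$ of $t$. *)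

(* Defs.v *)
From HB Require Import structures.
From mathcomp Require Import all_boot all_order all_algebra all_fingroup all_field.
Set Implicit Arguments. Unset Strict Implicit. Unset Printing Implicit Defensive.
Import Order.TTheory GRing.Theory Num.Theory.

Definition binop (n : nat) := {ffun 'I_n * 'I_n -> 'I_n}.

Definition associative_op n (s : binop n) : bool :=
  [forall x, [forall y, [forall z, s (x, s (y, z)) == s (s (x, y), z)]]].

Definition sq_set n (s : binop n) : {set 'I_n} :=
  [set s (x, y) | x : 'I_n, y : 'I_n].
Definition cube_set n (s : binop n) : {set 'I_n} :=
  [set s (s (xy.1, xy.2), z) | xy : 'I_n * 'I_n, z : 'I_n].

Definition nilp3 n (s : binop n) : bool :=
  (#|cube_set s| == 1%N) && (1 < #|sq_set s|)%N.

Definition nilp3_semigroups n : {set binop n} :=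
  [set s | associative_op s && nilp3 s].

Definition sg_iso n (s t : binop n) : bool :=
  [exists f : {perm 'I_n}, [forall x, [forall y, f (s (x, y)) == t (f x, f y)]]].

Definition num_nilp3 n : nat :=
  #|[set [set t in nilp3_semigroups n | sg_iso s t] | s in nilp3_semigroups n]|.

(* A partition j of n is represented by its multiplicity function
   i |-> j_i (number of parts equal to i), for 0 <= i <= n, with j_0 = 0
   and sum_i i * j_i = n. *)
Definition mults (n : nat) := {ffun 'I_n.+1 -> 'I_n.+1}.

Definition is_part n (j : mults n) : bool :=
  (j ord0 == ord0) && (\sum_(i < n.+1) i * j i == n)%N.

Definition mult n (j : mults n) (i : nat) : nat :=
  if (i < n.+1)%N then nat_of_ord (j (inord i)) else 0%N.

Local Open Scope ring_scope.

Definition Nfun (p q : nat) : rat :=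
  \sum_(j : mults (q - 1) | is_part j)
   \sum_(k : mults (p - q) | is_part k)
     ((\prod_(1 <= i < q) ((mult j i)`! * i ^ mult j i)%N%:R
        * \prod_(1 <= i < (p - q).+1) ((mult k i)`! * i ^ mult k i)%N%:R)^-1
      * \prod_(1 <= a < (p - q).+1) \prod_(1 <= b < (p - q).+1)
          ((1 + \sum_(d <- divisors (lcmn a b)) d * mult j d)
             ^ (mult k a * mult k b * gcdn a b))%N%:R).

Definition a_bound (n : nat) : int :=
  Num.floor ((n%:R : algC) + 2^-1 - sqrtC (n%:R - 3%:R / 4%:R)).

(* Main.v *)
Require Import Defs.
From HB Require Import structures.
From mathcomp Require Import all_boot all_order all_algebra all_fingroup all_field.
From mathcomp Require Import zify ring.
Import Order.TTheory GRing.Theory Num.Theory.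
Set Implicit Arguments. Unset Strict Implicit. Unset Printing Implicit Defensive.
Local Open Scope nat_scope.

(* A nilpotent semigroup of degree 3 with |S^2| = m is the same as a table
   A x A -> B + {0} hitting every point of B, where A = S \ S^2 has n - m points
   and B = S^2 \ {0} has m - 1; associativity is automatic because all triple
   products are 0.  Isomorphisms of semigroups are the elements of
   Sym(A) x Sym(B), so one counts orbits of surjective tables.  Orbits of
   non-surjective tables correspond to orbits of all tables over B minus a
   point, which produces the difference N(n, m) - N(n-1, m-1), once N(p, q) is
   identified, by Burnside, with the number of orbits of all tables.  The bound
   a(n) is the largest m with m - 1 <= (n - m)^2, beyond which no table is
   surjective. *)

(** * Permutations with a given cycle type *)

(** The weights in [Nfun] arise when Burnside's sum over permutations is regrouped by cycle type,
    which requires the size of each conjugacy class; this is found by induction, peeling off a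
    transposition that frees one point. A table fixed by a pair of permutations is an equivariant
    map, so on each orbit [C] of pairs it amounts to one value fixed by the [#|C|]-th power of the
    permutation of values: zero always qualifies (the summand 1), and so does every point on a cycle
    whose length divides lcm(a, b). The exponent counts such orbits. That an isomorphism of
    semigroups restricts to A and to B relies on surjectivity: only then is B + {0} exactly the set
    of products, which every isomorphism preserves. The constants 1/2 and 3/4 in a(n) come from
    completing the square in m - 1 <= (n - m)^2. *)

Section CycleCounts.
Variable T : finType.
Implicit Types (s : {perm T}) (A : {set T}) (x y z : T).

Definition num_cycles s A i := #|[set C in porbit s @: A | #|C| == i]|.

Lemma porbit_sub s A x :
  x \in A -> (forall z, z \in A -> s z \in A) -> porbit s x \subset A.
Proof.
move=> xA sA; apply/subsetP=> _ /porbitP[i ->].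
elim: i => [|i IH]; first by rewrite expg0 perm1.
by rewrite expgSr permM sA.
Qed.

Lemma mem_porbit_next s x z : (s z \in porbit s x) = (z \in porbit s x).
Proof.
have := porbit_perm s 1 z; rewrite expg1 => e.
by rewrite -!eq_porbit_mem e.
Qed.

(** A stable set is a union of orbits, so the fibre of [porbit s] over each orbit that meets [A] is
    that whole orbit, of size [l]. *)
Lemma card_porbit_imset s A l :
    (forall z, z \in A -> s z \in A) ->
    (forall z, z \in A -> #|porbit s z| = l) ->
  #|porbit s @: A| * l = #|A|.
Proof.
move=> sA cA; rewrite -[RHS]sum1_card (partition_big_imset (porbit s)) /=.
rewrite -sum_nat_const; apply: eq_bigr => _ /imsetP[x xA ->].
rewrite -(cA x xA) -sum1_card; apply: eq_bigl => z.
rewrite eq_porbit_mem; have [zx|] := boolP (z \in porbit s x); last by rewrite andbF.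
by rewrite andbT; rewrite (subsetP (porbit_sub xA sA)).
Qed.

Lemma num_cyclesM s A i : (forall z, z \in A -> s z \in A) ->
  num_cycles s A i * i = #|[set x in A | #|porbit s x| == i]|.
Proof.
move=> sA; rewrite -(@card_porbit_imset s _ i); last 2 first.
- move=> z; rewrite !inE => /andP[zA zi]; rewrite sA //=.
  by have := porbit_perm s 1 z; rewrite expg1 => ->.
- by move=> z; rewrite !inE => /andP[_ /eqP].
congr (_ * _); rewrite /num_cycles; congr #|pred_of_set _|.
apply/setP=> C; rewrite !inE; apply/andP/imsetP.
  by case=> /imsetP[x xA ->] ci; exists x; rewrite ?inE ?xA.
by case=> x; rewrite inE => /andP[xA ci] ->; rewrite imset_f.
Qed.

Lemma porbit_fix s x : s x = x -> porbit s x = [set x].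
Proof.
move=> sx; apply/eqP; rewrite eqEsubset sub1set porbit_id andbT.
by apply: porbit_sub => [|z]; rewrite ?set11 // inE => /eqP->; rewrite sx set11.
Qed.

Lemma porbit_sub_perm_on s A x : perm_on A s -> x \in A -> porbit s x \subset A.
Proof. by move=> sA xA; apply: porbit_sub => // z; rewrite (perm_closed _ sA). Qed.

Lemma num_cycles_fix s A x i : perm_on A s -> x \notin A ->
  num_cycles s (x |: A) i = num_cycles s A i + (i == 1).
Proof.
move=> sA xA; have sx : s x = x by apply: (out_perm sA).
rewrite /num_cycles imsetU1 (porbit_fix sx).
have nx : [set x] \notin porbit s @: A.
  apply/negP => /imsetP[y yA /setP/(_ x)]; rewrite set11 => /esym xy.
  by move: xA; rewrite (subsetP (porbit_sub_perm_on sA yA)).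
have [->|ni] := eqVneq i 1.
  rewrite addn1 (_ : [set C in _ | _] = [set x] |: [set C in porbit s @: A | #|C| == 1]).
    by rewrite cardsU1 !inE (negPf nx).
  by apply/setP=> C; rewrite !inE; case: eqVneq => [->|//]; rewrite cards1.
rewrite addn0; congr #|pred_of_set _|; apply/setP=> C; rewrite !inE.
by case: (eqVneq C [set x]) => [->|] //=; rewrite cards1 eq_sym (negPf ni) andbF.
Qed.

Section Insert.
Variables (s : {perm T}) (A : {set T}) (x y : T).
Hypotheses (sA : perm_on A s) (xA : x \notin A) (yA : y \in A).
(** The left factor acts first, so [t] sends [y] to [x] and [x] to [s y]: the point [x] is spliced
    into the cycle of [y], right after [y]. *)
Let t : {perm T} := (tperm x y * s)%g.

Let sx : s x = x. Proof. exact: out_perm sA xA. Qed.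
Let nxy : x != y. Proof. by apply: contraNneq xA => ->. Qed.
Let tx : t x = s y. Proof. by rewrite permM tpermL. Qed.
Let ty : t y = x. Proof. by rewrite permM tpermR. Qed.
Let tz z : z != x -> z != y -> t z = s z.
Proof. by move=> zx zy; rewrite permM tpermD // eq_sym. Qed.
Let xny : x \notin porbit s y.
Proof. by apply: contra xA; apply/subsetP/porbit_sub_perm_on. Qed.

Lemma porbit_insert : porbit t y = x |: porbit s y.
Proof.
apply/eqP; rewrite eqEsubset; apply/andP; split.
  apply: porbit_sub => [|z]; first by rewrite !inE porbit_id orbT.
  rewrite !inE; have [-> _|zx] := eqVneq z x.
    by rewrite tx mem_porbit_next porbit_id orbT.
  have [-> _|zy /= zs] := eqVneq z y; first by rewrite ty eqxx.
  by rewrite tz // mem_porbit_next zs orbT.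
have xt : x \in porbit t y by rewrite -{1}ty mem_porbit_next porbit_id.
rewrite subUset sub1set xt /=.
(* With [x] removed, the [t]-orbit is stable under [s], because [s] jumps directly from [y] to
   [t x]. *)
have /subset_trans : porbit s y \subset porbit t y :\ x.
  apply: porbit_sub => [|z]; first by rewrite !inE porbit_id eq_sym nxy.
  rewrite !inE => /andP[zx zt]; rewrite -{1}sx (inj_eq perm_inj) zx /=.
  have [->|zy] := eqVneq z y; first by rewrite -tx mem_porbit_next.
  by rewrite -tz // mem_porbit_next.
by apply; apply: subsetDl.
Qed.

Lemma porbit_insert_out z : z \notin x |: porbit s y -> porbit t z = porbit s z.
Proof.
rewrite !inE negb_or => /andP[zx zy].
have nx : x \notin porbit s z by rewrite porbit_sym (porbit_fix sx) inE.
have ny : y \notin porbit s z by rewrite porbit_sym.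
have ts u : u \in porbit s z -> t u = s u.
  by move=> uz; apply: tz; [apply: contraNneq nx => <-|apply: contraNneq ny => <-].
have sub : porbit t z \subset porbit s z.
  by apply: porbit_sub => [|u uz]; rewrite ?porbit_id // ts // mem_porbit_next.
apply/eqP; rewrite eqEsubset sub /=.
apply: porbit_sub => [|u uz]; first exact: porbit_id.
by rewrite -ts ?mem_porbit_next //; apply: (subsetP sub).
Qed.

(** The cycle of [y] gains one point and all others survive. The correction terms stand on both
    sides so that no truncated subtraction occurs. *)
Lemma num_cycles_insert i :
  num_cycles t (x |: A) i + (i == #|porbit s y|) =
  num_cycles s A i + (i == #|porbit s y|.+1).
Proof.
set C := porbit s y.
have eqo : porbit t @: (x |: A) = (x |: C) |: (porbit s @: A :\ C).
  apply/setP=> D; apply/imsetP/idP.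
    case=> z zA ->; rewrite !inE.
    have [zC|zC] := boolP (z \in x |: C).
      by rewrite -porbit_insert eq_porbit_mem porbit_insert zC.
    rewrite porbit_insert_out //; apply/orP; right.
    move: zC; rewrite !inE negb_or => /andP[zx zC]; rewrite eq_porbit_mem zC /=.
    by apply: imset_f; move: zA; rewrite !inE (negPf zx).
  rewrite !inE => /orP[/eqP->|/andP[DC /imsetP[z zA Dz]]].
    by exists y; rewrite ?porbit_insert // !inE yA orbT.
  exists z; first by rewrite !inE zA orbT.
  rewrite porbit_insert_out // !inE negb_or -eq_porbit_mem -Dz DC andbT.
  by apply: contraNneq xA => <-.
have nin : x |: C \notin porbit s @: A :\ C.
  rewrite !inE negb_and; apply/orP; right; apply/negP => /imsetP[z zA /setP/(_ x)].
  rewrite !inE eqxx /= => /esym xz.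
  by move: xA; rewrite (subsetP (porbit_sub_perm_on sA zA)).
have CA : C \in porbit s @: A by apply: imset_f.
rewrite /num_cycles eqo.
have -> : #|[set D in (x |: C) |: (porbit s @: A :\ C) | #|D| == i]| =
          (#|C|.+1 == i) + #|[set D in porbit s @: A :\ C | #|D| == i]|.
  rewrite (cardsD1 (x |: C)) !inE eqxx /= cardsU1 xny; congr (_ + _).
  congr #|pred_of_set _|; apply/setP=> D; rewrite !inE.
  by case: eqVneq => //= ->; move: nin; rewrite !inE => /negPf->.
have -> : #|[set D in porbit s @: A | #|D| == i]| =
          (#|C| == i) + #|[set D in porbit s @: A :\ C | #|D| == i]|.
  rewrite (cardsD1 C) !inE CA /=; congr (_ + _).
  by congr #|pred_of_set _|; apply/setP=> D; rewrite !inE andbA.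
rewrite !(eq_sym i); lia.
Qed.

End Insert.
End CycleCounts.

Lemma sum_ord_first (F : nat -> nat) M : 0 < M ->
  \sum_(c < M) F c = F 0 + \sum_(c < M) (if 0 < c then F c else 0).
Proof. by case: M => // M _; rewrite !big_ord_recl. Qed.

(** * Size of a conjugacy class, by deleting one point at a time *)

Section CycleTypes.
Variables (T : finType) (N : nat).
Implicit Types (s : {perm T}) (A : {set T}) (g : nat -> nat).

(** The bound [N] on cycle lengths stays the same while [A] shrinks in the induction, so all types
    are compared on one index range. *)
Definition of_type A g : {set {perm T}} :=
  [set s | perm_on A s & [forall i : 'I_N.+1, num_cycles s A i == g i]].

Definition centralizer_order g := \prod_(i < N.+1) ((g i)`! * i ^ g i).

(* [grow_type g c] is the cycle type left when a point is deleted from a cycle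
   of length [c + 1] of a permutation of type [g]. *)
Definition grow_type g c i := g i + ((i == c) && (0 < c)) - (i == c.+1).

(** Ways to put the deleted point back: after any point on one of the [(g c).+1] cycles of length
    [c] of the reduced permutation, or, if [c] is 0, as a fixed point. *)
Definition num_insertions g c := if c is 0 then 1 else c * (g c).+1.

(** Only the factors at [c.+1] and [c] change: the first loses [c.+1 * g c.+1], and for positive [c]
    the second gains [c * (g c).+1], which is [num_insertions g c]. *)
Lemma centralizer_order_grow g c : c < N -> 0 < g c.+1 ->
  num_insertions g c * centralizer_order g =
  c.+1 * g c.+1 * centralizer_order (grow_type g c).
Proof.
move=> cN gc; have c1N : c.+1 < N.+1 by [].
pose F a i := a`! * i ^ a.
have FS a i : F a.+1 i = a.+1 * i * F a i by rewrite /F factS expnS; lia.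
rewrite /centralizer_order (bigD1 (Ordinal c1N)) // [in RHS](bigD1 (Ordinal c1N)) //=.
rewrite -/(F (g c.+1) c.+1) -/(F (grow_type g c c.+1) c.+1).
have -> : grow_type g c c.+1 = (g c.+1).-1.
  by rewrite /grow_type eqxx eqn_leq ltnn addn0 subn1.
rewrite -{1}(prednK gc) FS (prednK gc).
case: c cN c1N gc => [|c] cN c1N gc.
  rewrite /num_insertions mul1n.
  under [in RHS]eq_bigr => i ni.
    have -> : grow_type g 0 i = g i.
      by rewrite /grow_type -val_eqE /= in ni *; rewrite (negPf ni) andbF subn0 addn0.
    over.
  lia.
rewrite /num_insertions.
have c2N : c.+1 < N.+1 by apply: ltnW.
rewrite (bigD1 (Ordinal c2N)) /=; last by rewrite -val_eqE /=; lia.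
rewrite [in RHS](bigD1 (Ordinal c2N)) /=; last by rewrite -val_eqE /=; lia.
rewrite -/(F (g c.+1) c.+1) -/(F (grow_type g c.+1 c.+1) c.+1).
have -> : grow_type g c.+1 c.+1 = (g c.+1).+1.
  by rewrite /grow_type eqxx /= [c.+1 == c.+2]eqn_leq ltnn andbF subn0 addn1.
rewrite FS.
under [in RHS]eq_bigr => i /andP[ni ni'].
  have -> : grow_type g c.+1 i = g i.
    by rewrite /grow_type -!val_eqE /= in ni ni' *; rewrite (negPf ni) (negPf ni') subn0 addn0.
  over.
lia.
Qed.

Lemma sum_grow_type g c : c < N -> 0 < g c.+1 ->
  (\sum_(i < N.+1) i * grow_type g c i).+1 = \sum_(i < N.+1) i * g i.
Proof.
move=> cN gc.
have del (d : nat) : d < N.+1 -> \sum_(i < N.+1) i * (i == d :> nat) = d.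
  move=> dN; rewrite (bigD1 (Ordinal dN)) //= eqxx muln1 big1 ?addn0 // => i.
  by rewrite -val_eqE /= => /negPf->; rewrite muln0.
(* Adding the removed cycle back on one side undoes the truncated subtraction in [grow_type]. *)
have e : \sum_(i < N.+1) (i * grow_type g c i + i * (i == c.+1 :> nat)) =
         \sum_(i < N.+1) (i * g i + i * (i == c :> nat)).
  apply: eq_bigr => i _; rewrite -!mulnDr /grow_type.
  case: (eqVneq (i : nat) c.+1) => [->|_].
    by rewrite [c.+1 == c]eqn_leq ltnn /= addn0 subnK.
  by case: (eqVneq (i : nat) c) => [->|_]; case: (posnP c) => /= c0; lia.
move: e; rewrite !big_split /= !del //; [lia|exact: ltnW].
Qed.

(** The trivial factor [tperm x x] gives the case where [x] is fixed the same shape as the other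
    terms of the recursion below. *)
Lemma of_type_fix g A x : x \notin A -> 0 < N ->
  [set s | perm_on A s & (tperm x x * s)%g \in of_type (x |: A) g] =
  if 0 < g 1 then of_type A (grow_type g 0) else set0.
Proof.
move=> xA N0; apply/setP=> s; rewrite inE tperm1 mul1g inE.
have [sA|nsA] := boolP (perm_on A s); last first.
  by case: ifP; rewrite inE ?(negPf nsA).
have sxA : perm_on (x |: A) s by apply: subset_trans sA (subsetUr _ _).
rewrite sxA /=; case: ifPn => g1; last first.
  rewrite inE; apply/negbTE/forallP => /(_ (Ordinal (N0 : 1 < N.+1))) /=.
  by rewrite num_cycles_fix // addn1 => /eqP e; rewrite -e in g1.
rewrite !inE sA /=; apply: eq_forallb => i; rewrite num_cycles_fix // /grow_type.
rewrite andbF addn0; case: (eqVneq (i : nat) 1) => [->|_]; lia.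
Qed.

Lemma of_type_insert g A x y s (c := #|porbit s y|) :
    x \notin A -> y \in A -> c < N -> perm_on A s ->
  ((tperm x y * s)%g \in of_type (x |: A) g) =
  (0 < g c.+1) && (s \in of_type A (grow_type g c)).
Proof.
move=> xA yA cN sA; have c0 : 0 < c by rewrite lt0n card_porbit_neq0.
have -> : (tperm x y * s)%g \in of_type (x |: A) g =
    [forall i : 'I_N.+1, num_cycles s A i + (i == c.+1 :> nat) == g i + (i == c :> nat)].
  rewrite inE; have -> /= : perm_on (x |: A) (tperm x y * s)%g.
    apply: perm_onM; last by apply: subset_trans sA (subsetUr _ _).
    apply: subset_trans (tperm_on x y) _; apply/subsetP=> z; rewrite !inE.
    by case/orP=> /eqP->; rewrite ?eqxx ?yA ?orbT.
  apply: eq_forallb => i; rewrite -(num_cycles_insert sA xA yA) -/c eqn_add2r //.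
have c1N : c.+1 < N.+1 by [].
case: (posnP (g c.+1)) => /= gc.
  apply/negbTE/forallP => /(_ (Ordinal c1N)) /=; rewrite gc eqxx; lia.
rewrite inE sA /=; apply: eq_forallb => i; rewrite /grow_type c0 andbT.
by case: (eqVneq (i : nat) c.+1) => [->|_]; case: eqVneq; lia.
Qed.

(** The permutations are sorted by the preimage [y] of [x]; each is [tperm x y] times a permutation
    supported in [A]. The choice [y = x] gives the term [c = 0]; the others are grouped by the
    length [c] of the cycle of [y]. *)
Lemma card_of_type_rec g A x : x \notin A -> #|A| < N ->
  #|of_type (x |: A) g| =
  \sum_(c < N | 0 < g c.+1) num_insertions g c * #|of_type A (grow_type g c)|.
Proof.
move=> xA AN; have N0 : 0 < N by apply: leq_trans AN.
have -> : #|of_type (x |: A) g| = \sum_(y in x |: A)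
   #|[set s | perm_on A s & (tperm x y * s)%g \in of_type (x |: A) g]|.
  rewrite -sum1_card (partition_big (fun s => s^-1%g x) (mem (x |: A))) /=; last first.
    by move=> s; rewrite inE => /andP[/perm_onV/perm_closed -> _]; rewrite setU11.
  apply: eq_bigr => y yA; rewrite -sum1_card.
  rewrite (reindex_inj (mulgI (tperm x y))) /=; apply: eq_bigl => s; rewrite !inE.
  rewrite [RHS]andbA [LHS]andbAC; congr andb.
  rewrite invMg tpermV permM (can2_eq (tpermK x y) (tpermK x y)) tpermR.
  have tA : perm_on (x |: A) (tperm x y).
    apply: subset_trans (tperm_on x y) _; apply/subsetP=> z; rewrite [z \in [set _; _]]inE !in_set1.
    by case/orP=> /eqP->; rewrite ?setU11.
  apply/andP/andP => [[tsA /eqP sx]|[sA tsA]].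
    split=> //; have {}tsA : perm_on (x |: A) s.
      by have := perm_onM tA tsA; rewrite mulgA tperm2 mul1g.
    have {}sx : s x = x by rewrite -{1}sx permKV.
    apply/subsetP=> z zs; have := subsetP tsA z zs; rewrite !inE.
    by case: eqVneq => // zx; move: zs; rewrite inE zx sx eqxx.
  by rewrite tsA (out_perm (perm_onV sA) xA).
rewrite big_setU1 //= of_type_fix //.
have -> : \sum_(y in A) #|[set s | perm_on A s & (tperm x y * s)%g \in of_type (x |: A) g]| =
   \sum_(c < N | (0 < c) && (0 < g c.+1)) num_insertions g c * #|of_type A (grow_type g c)|.
  (* Double counting of pairs [(y, s)]: for a given [s] of the reduced type, the admissible [y] are
     the points on its cycles of length [c]. *)
  transitivity (\sum_(y in A) \sum_(s | perm_on A s) \sum_(c < N | (0 < c) && (0 < g c.+1))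
        ((s \in of_type A (grow_type g c)) && (#|porbit s y| == c) : nat)).
    apply: eq_bigr => y yA; rewrite -sum1_card.
    under eq_bigl => s do rewrite inE.
    rewrite big_mkcondr; apply: eq_bigr => s sA.
    have cN : #|porbit s y| < N.
      apply: leq_ltn_trans AN; apply: subset_leq_card; exact: porbit_sub_perm_on.
    rewrite of_type_insert // big_mkcond (bigD1 (Ordinal cN)) //= eqxx andbT.
    rewrite [0 < #|_|]lt0n card_porbit_neq0 /= big1 => [|c]; last first.
      by rewrite -val_eqE eq_sym /= => /negPf->; rewrite andbF; case: ifP.
    by rewrite addn0; case: (0 < _); case: (_ \in _).
  rewrite exchange_big (eq_bigr _ (fun s _ => exchange_big _ _ _ _ _ _)) exchange_big /=.
  apply: eq_bigr => c /andP[c0 gc].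
  rewrite (bigID (mem (of_type A (grow_type g c)))) /= [X in _ + X]big1 ?addn0; last first.
    by move=> s /andP[_ /negPf->]; rewrite big1.
  transitivity (\sum_(s in of_type A (grow_type g c)) num_insertions g c); last first.
    by rewrite sum_nat_const mulnC.
  apply: eq_big => [s|s /andP[sA sE]]; first by rewrite inE; case: perm_on.
  rewrite sE; transitivity #|[set y in A | #|porbit s y| == c]|.
    rewrite -sum1_card -big_mkcondr; apply: eq_bigl => y; by rewrite inE.
  rewrite -num_cyclesM; last by move=> z; rewrite (perm_closed _ sA).
  have /eqP -> : num_cycles s A c == grow_type g c c.
    by move: sE; rewrite inE => /andP[_ /forallP/(_ (widen_ord (leqnSn N) c))].
  case: (c : nat) c0 => //= d _; rewrite /grow_type eqxx /= [_ == d.+2]eqn_leq ltnn andbF.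
  lia.
rewrite [in RHS]big_mkcond.
rewrite (sum_ord_first (fun c => if 0 < g c.+1 then
   num_insertions g c * #|of_type A (grow_type g c)| else 0) N0) mul1n.
congr (_ + _); first by case: ifP; rewrite ?cards0.
by rewrite big_mkcond; apply: eq_bigr => c _; case: (0 < c).
Qed.

Theorem card_of_type g A : #|A| <= N -> g 0 = 0 ->
  \sum_(i < N.+1) i * g i = #|A| ->
  #|of_type A g| * centralizer_order g = #|A|`!.
Proof.
move=> AN g0 sg; have [n An] : exists n, #|A| = n by exists #|A|.
elim: n => [|n IH] in A g AN g0 sg An *.
  have gi (i : 'I_N.+1) : g i = 0.
    move/eqP: sg; rewrite An sum_nat_eq0 => /forall_inP/(_ i isT).
    by rewrite muln_eq0 => /orP[/eqP->|/eqP].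
  rewrite An /centralizer_order big1 ?muln1 => [|i _]; last by rewrite gi.
  move/eqP: An; rewrite cards_eq0 => /eqP->.
  rewrite (_ : of_type _ _ = [set 1%g]) ?cards1 //; apply/setP=> s; rewrite !inE.
  have -> : [forall i : 'I_N.+1, num_cycles s set0 i == g i].
    apply/forallP=> i; rewrite gi /num_cycles imset0 cards_eq0.
    by apply/eqP/setP=> C; rewrite !inE.
  rewrite andbT; apply/idP/eqP => [/perm_on_id->|->]; rewrite ?cards0 //.
  exact: perm_on1.
have /card_gt0P[x xA] : 0 < #|A| by rewrite An.
have An' : #|A :\ x| = n by move: An; rewrite (cardsD1 x) xA => -[].
have nN : n < N by rewrite -An.
rewrite -{1}(setD1K xA) card_of_type_rec ?An' ?setD11 // big_distrl /=.
(* By induction each term is n! times the number of points on cycles of length [c.+1]; these numbers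
   add up to [n.+1]. *)
transitivity (\sum_(c < N) c.+1 * g c.+1 * n`!).
  rewrite big_mkcond; apply: eq_bigr => c _; case: posnP => [->|gc /=].
    by rewrite muln0.
  rewrite mulnAC centralizer_order_grow // -mulnA [centralizer_order _ * _]mulnC.
  rewrite IH ?An' // ?(ltnW nN) //; last first.
    by apply/eqP; rewrite -eqSS sum_grow_type // sg An.
  by rewrite /grow_type g0; case: (c : nat).
by rewrite -big_distrl /= An factS -An -sg big_ord_recl mul0n.
Qed.

End CycleTypes.

(** * Tables fixed by a pair of permutations *)

Section Period.
Variable T : finType.
Implicit Types (s : {perm T}) (x y : T).

(** Here [l] is any period, not the least: it will be an orbit length of [p] serving as a period of
    [r]. *)
Lemma permX_mod s x l i : (s ^+ l)%g x = x -> (s ^+ (i %% l))%g x = (s ^+ i)%g x.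
Proof.
move=> sl; rewrite [in RHS](divn_eq i l) expgD permM mulnC expgM.
by congr (_ _); symmetry; apply: permX_fix.
Qed.

Lemma permX_porbit s x : (s ^+ #|porbit s x|)%g x = x.
Proof. by rewrite permX iter_porbit. Qed.

Lemma eq_permX s x i j :
  ((s ^+ i)%g x == (s ^+ j)%g x) = (i == j %[mod #|porbit s x|]).
Proof.
rewrite -(permX_mod i (permX_porbit s x)) -(permX_mod j (permX_porbit s x)) !permX.
have l0 : 0 < #|porbit s x| by rewrite lt0n card_porbit_neq0.
rewrite -!(nth_traject _ (ltn_pmod _ l0)).
by rewrite nth_uniq ?size_traject ?ltn_pmod // uniq_traject_porbit.
Qed.

Lemma permX_fixE s x i : ((s ^+ i)%g x == x) = (#|porbit s x| %| i).
Proof. by rewrite -[X in _ == X](perm1 x) -(expg0 s) eq_permX mod0n. Qed.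

End Period.

Section Equivariant.
Variables (X Y : finType) (y0 : Y) (p : {perm X}) (r : {perm Y}).

(** The pick depends on the orbit only as a set, hence is one base point per orbit; the default is
    never reached, as [x] lies in its own orbit. *)
Let start x := odflt x [pick z in porbit p x].

Let mem_start x : x \in porbit p (start x).
Proof.
rewrite /start; case: pickP => [z|/(_ x)] /=; last by rewrite porbit_id.
by rewrite porbit_sym.
Qed.

Let porbit_start x : porbit p (start x) = porbit p x.
Proof. by symmetry; apply/eqP; rewrite eq_porbit_mem mem_start. Qed.

Let start_eq x y : porbit p x = porbit p y -> start x = start y.
Proof.
rewrite /start => ->; case: pickP => [//|/(_ y)]; by rewrite porbit_id.
Qed.

Let k x := index x (traject p (start x) #|porbit p x|).

Let start_k x : (p ^+ k x)%g (start x) = x.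
Proof.
have := mem_start x; rewrite porbit_traject porbit_start => xt.
rewrite permX -[RHS](nth_index (start x) xt) nth_traject //.
by move: xt; rewrite -index_mem size_traject.
Qed.

(* An equivariant map is freely determined by its values at one chosen point of
   each orbit [C], which must be fixed by [r ^+ #|C|]. *)
Lemma card_equivariant :
  #|[set f : {ffun X -> Y} | [forall x, f (p x) == r (f x)]]| =
  \prod_(C in porbits p) #|[set y | (r ^+ #|C|)%g y == y]|.
Proof.
pose F (C : {set X}) : pred Y := fun y => (r ^+ #|C|)%g y == y.
transitivity #|pfamily y0 (mem (porbits p)) F|; last first.
  rewrite card_pfamily foldrE big_map big_enum /=.
  by apply: eq_bigr => C _; apply: eq_card => y; rewrite inE.
(* [G] records [f] at the base points; the value [y0] off the orbits is the support condition of
   [pfamily]. *)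
pose G (f : {ffun X -> Y}) : {ffun {set X} -> Y} :=
  [ffun C : {set X} => if [pick z in C] is Some z then
      if C \in porbits p then f z else y0 else y0].
have Gstart f x : G f (porbit p x) = f (start x).
  rewrite ffunE /start; case: pickP => [z zx|/(_ x)]; last by rewrite porbit_id.
  by rewrite imset_f.
have eqX f i x : (forall x, f (p x) = r (f x)) -> f ((p ^+ i)%g x) = (r ^+ i)%g (f x).
  move=> fe; elim: i => [|i IH]; first by rewrite !expg0 !perm1.
  by rewrite !expgSr !permM fe IH.
rewrite -(card_in_imset (f := G)) => [|f1 f2]; last first.
  rewrite !inE => /forallP e1 /forallP e2 /ffunP G12; apply/ffunP=> x.
  rewrite -(start_k x) !eqX; try by move=> z; apply/eqP.
  by rewrite -!Gstart G12.
apply: eq_card => h; apply/imsetP/pfamilyP.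
  case=> f; rewrite inE => /forallP fe ->; split.
    apply/supportP=> C Cp; rewrite ffunE (negPf Cp); by case: pickP.
  move=> _ /imsetP[x _ ->]; rewrite Gstart -porbit_start /F /in_mem /=.
  by rewrite -eqX ?permX_porbit // => z; apply/eqP.
case=> /supportP h0 hF.
have hfix x : (r ^+ #|porbit p x|)%g (h (porbit p x)) = h (porbit p x).
  by apply/eqP; apply: (hF (porbit p x)); apply: imset_f.
exists [ffun x => (r ^+ k x)%g (h (porbit p x))].
  rewrite inE; apply/forallP=> x; rewrite !ffunE.
  have px : porbit p (p x) = porbit p x by have := porbit_perm p 1 x; rewrite expg1.
  rewrite px -permM -expgSr.
  (* The exponent [k] drops back to 0 when [p] returns to the base point, so [k (p x)] and
     [(k x).+1] agree only modulo the orbit length; the fixed-value condition makes that enough. *)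
  have hl := hfix x; apply/eqP; rewrite -(permX_mod (k (p x)) hl) -(permX_mod (k x).+1 hl).
  suff /eqP-> : k (p x) == (k x).+1 %[mod #|porbit p x|] by [].
  have := eq_permX p (start x) (k (p x)) (k x).+1; rewrite porbit_start => <-.
  by rewrite expgSr permM start_k -(start_eq px) start_k.
apply/ffunP=> C; have [/imsetP[x _ ->]|nC] := boolP (C \in porbits p); last first.
  by rewrite ffunE (negPf nC) h0 //; case: pickP.
rewrite Gstart ffunE porbit_start.
rewrite -(permX_mod _ (hfix x)).
have -> : k (start x) %% #|porbit p x| = 0; last by rewrite expg0 perm1.
rewrite -(mod0n #|porbit p x|); apply/eqP.
have := eq_permX p (start x) (k (start x)) 0; rewrite porbit_start => <-.
have := start_k (start x); rewrite (start_eq (porbit_start x)) => ->.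
by rewrite expg0 perm1.
Qed.

End Equivariant.

(** * Induced permutations of pairs and of values with a zero *)

Section PairOption.
Variables (A B : finType).
Implicit Types (t : {perm A}) (s : {perm B}).

Definition pair_fun t (p : A * A) := (t p.1, t p.2).

Lemma pair_fun_inj t : injective (pair_fun t).
Proof. by move=> [a b] [c d] [/perm_inj-> /perm_inj->]. Qed.

Definition pair_perm t : {perm A * A} := perm (@pair_fun_inj t).

Definition option_perm s : {perm option B} := perm (inj_omap (@perm_inj _ s)).

Lemma pair_permX t i a b : (pair_perm t ^+ i)%g (a, b) = ((t ^+ i)%g a, (t ^+ i)%g b).
Proof.
elim: i => [|i IH]; first by rewrite !expg0 !perm1.
by rewrite !expgSr !permM IH permE.
Qed.

Lemma option_permX s i o : (option_perm s ^+ i)%g o = omap (s ^+ i)%g o.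
Proof.
elim: i => [|i IH]; first by case: o => [b|]; rewrite !expg0 /= !perm1.
by rewrite expgSr permM IH permE; case: o {IH} => //= b; rewrite expgSr permM.
Qed.

(** A power fixes a pair exactly when it fixes both coordinates, that is, when both cycle lengths
    divide the exponent. *)
Lemma card_porbit_pair t a b :
  #|porbit (pair_perm t) (a, b)| = lcmn #|porbit t a| #|porbit t b|.
Proof.
apply/eqP; rewrite eqn_dvd -permX_fixE pair_permX dvdn_lcm.
rewrite -!permX_fixE xpair_eqE !permX_fixE dvdn_lcml dvdn_lcmr /=.
by rewrite -!permX_fixE -xpair_eqE -pair_permX permX_porbit.
Qed.

Lemma card_fix_option s l : 0 < l ->
  #|[set o | (option_perm s ^+ l)%g o == o]| =
  1 + \sum_(d <- divisors l) d * num_cycles s setT d.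
Proof.
move=> l0; rewrite (cardsD1 None) inE option_permX eqxx; congr (_ + _).
transitivity #|Some @: [set b | #|porbit s b| %| l]|.
  apply: eq_card => -[b|]; rewrite !inE /=; last by symmetry; apply/imsetP=> -[].
  by rewrite mem_imset ?inE; [rewrite option_permX -permX_fixE|move=> ? ? []].
rewrite card_imset; last by move=> ? ? [].
rewrite -sum1_card (eq_bigl (fun b => #|porbit s b| \in divisors l)); last first.
  by move=> b; rewrite inE dvdn_divisors.
transitivity (\sum_(d <- divisors l) \sum_(b : B | #|porbit s b| == d) 1).
  under [RHS]eq_bigr do rewrite big_mkcond.
  rewrite exchange_big big_mkcond /=; apply: eq_bigr => b _.
  rewrite -big_mkcond sum1_count.
  under eq_count do rewrite eq_sym.
  by rewrite -[count _ _]/(count_mem _ _) count_uniq_mem ?divisors_uniq //; case: (_ \in _).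
apply: eq_bigr => d _; rewrite mulnC num_cyclesM //.
  by rewrite -sum1_card; apply: eq_bigl => b; rewrite !inE.
Qed.

End PairOption.

Section NumCycles.
Variable T : finType.
Implicit Types (s : {perm T}).

Lemma num_cycles0 s A : num_cycles s A 0 = 0.
Proof.
apply/eqP; rewrite cards_eq0; apply/eqP/setP=> C; rewrite !inE cards_eq0.
apply/andP=> -[/imsetP[x _ ->] /eqP/setP/(_ x)]; by rewrite porbit_id inE.
Qed.

Lemma num_cycles_le s A i : num_cycles s A i <= #|A|.
Proof.
apply: leq_trans (leq_imset_card (porbit s) (mem A)); apply: subset_leq_card.
by apply/subsetP=> C; rewrite inE => /andP[].
Qed.

Lemma sum_num_cycles s : \sum_(i < #|T|.+1) i * num_cycles s setT i = #|T|.
Proof.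
rewrite -[RHS]cardsT -sum1_card.
rewrite (partition_big (fun x => inord #|porbit s x| : 'I_#|T|.+1) xpredT) //=.
apply: eq_bigr => i _; rewrite mulnC num_cyclesM // -sum1_card.
apply: eq_bigl => x; rewrite !inE -val_eqE /= inordK // ltnS.
exact: max_card.
Qed.

End NumCycles.

Lemma prodn_ord_from1 (F : nat -> nat) n :
  F 0 = 1 -> \prod_(1 <= i < n.+1) F i = \prod_(i < n.+1) F i.
Proof. by move=> F0; rewrite -(big_mkord xpredT) [RHS]big_ltn // F0 mul1n. Qed.

(** * Fixed tables and Burnside's count of orbits *)

Section FixedTables.
Variables (A B : finType).
Implicit Types (t : {perm A}) (s : {perm B}).

(** Together with its twin, this reads both coordinate cycle lengths off an orbit of pairs as a set,
    so orbits can be sorted by them. *)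
Lemma fst_porbit t a b : fst @: porbit (pair_perm t) (a, b) = porbit t a.
Proof.
apply/setP=> c; apply/imsetP/porbitP.
  by case=> _ /porbitP[i ->] ->; exists i; rewrite pair_permX.
by case=> i ->; exists ((pair_perm t ^+ i)%g (a, b)); rewrite ?mem_porbit ?pair_permX.
Qed.

Lemma snd_porbit t a b : snd @: porbit (pair_perm t) (a, b) = porbit t b.
Proof.
apply/setP=> c; apply/imsetP/porbitP.
  by case=> _ /porbitP[i ->] ->; exists i; rewrite pair_permX.
by case=> i ->; exists ((pair_perm t ^+ i)%g (a, b)); rewrite ?mem_porbit ?pair_permX.
Qed.

(* The [a * num_cycles a * b * num_cycles b] points lying on cycles of lengths
   [(a, b)] split into orbits of size [lcm(a, b)]. *)
Lemma card_pair_porbits t a b : 0 < a -> 0 < b ->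
  #|[set C in porbits (pair_perm t) | (#|fst @: C| == a) && (#|snd @: C| == b)]| =
  num_cycles t setT a * num_cycles t setT b * gcdn a b.
Proof.
move=> a0 b0; have l0 : 0 < lcmn a b by rewrite lcmn_gt0 a0.
pose S := [set p : A * A | (#|porbit t p.1| == a) && (#|porbit t p.2| == b)].
have -> : [set C in porbits (pair_perm t) | (#|fst @: C| == a) && (#|snd @: C| == b)]
          = porbit (pair_perm t) @: S.
  apply/setP=> C; rewrite inE; apply/andP/imsetP.
    case=> /imsetP[[x y] _ ->]; rewrite fst_porbit snd_porbit => xy.
    by exists (x, y); rewrite ?inE.
  case=> -[x y]; rewrite inE => xy ->; rewrite fst_porbit snd_porbit; split=> //.
  exact: imset_f.
apply/eqP; rewrite -(eqn_pmul2r l0) (card_porbit_imset (l := lcmn a b)); last 2 first.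
- case=> x y; rewrite !inE permE /=.
  have e z : porbit t (t z) = porbit t z by have := porbit_perm t 1 z; rewrite expg1.
  by rewrite !e.
- by case=> x y; rewrite inE card_porbit_pair => /andP[/eqP-> /eqP->].
have -> : S = setX [set x in setT | #|porbit t x| == a] [set x in setT | #|porbit t x| == b].
  by apply/setP=> -[x y]; rewrite !inE.
rewrite cardsX -!num_cyclesM //; have := muln_lcm_gcd a b.
set u := num_cycles _ _ _; set v := num_cycles _ _ _; nia.
Qed.

(** Orbits of pairs are grouped by their coordinate cycle lengths [(a, b)]. All orbits of a group
    have size lcm(a, b), hence contribute the same factor. *)
Lemma card_fixed_tables t s :
  #|[set w : {ffun A * A -> option B} |
      [forall p, w (pair_perm t p) == option_perm s (w p)]]| =
  \prod_(1 <= a < #|A|.+1) \prod_(1 <= b < #|A|.+1)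
    (1 + \sum_(d <- divisors (lcmn a b)) d * num_cycles s setT d)
      ^ (num_cycles t setT a * num_cycles t setT b * gcdn a b).
Proof.
rewrite (card_equivariant None).
pose n := #|A|; pose P (i : 'I_n.+1) := 0 < i.
pose ty (C : {set A * A}) : 'I_n.+1 * 'I_n.+1 := (inord #|fst @: C|, inord #|snd @: C|).
have tyE x y : ty (porbit (pair_perm t) (x, y)) = (inord #|porbit t x|, inord #|porbit t y|).
  by rewrite /ty fst_porbit snd_porbit.
have le z : #|porbit t z| < n.+1 by rewrite ltnS; apply: max_card.
rewrite (partition_big ty (fun ab => (P ab.1) && (P ab.2))) /=; last first.
  move=> _ /imsetP[[x y] _ ->]; rewrite fst_porbit snd_porbit /P !inordK //.
  by rewrite !lt0n !card_porbit_neq0.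
rewrite -(pair_big P P (fun a b => \prod_(C in porbits (pair_perm t) | ty C == (a, b))
   #|[set y | (option_perm s ^+ #|C|)%g y == y]|)) /=.
rewrite prodn_ord_from1; last first.
  by rewrite big1 // => b _; rewrite num_cycles0 !mul0n.
rewrite big_mkcond; apply: eq_bigr => a _; rewrite {1}/P; case: posnP => a0.
  by rewrite a0 big1 // => b _; rewrite num_cycles0 !mul0n.
rewrite prodn_ord_from1; last by rewrite num_cycles0 muln0 mul0n.
rewrite big_mkcond; apply: eq_bigr => b _; rewrite {1}/P; case: posnP => b0.
  by rewrite b0 num_cycles0 muln0 mul0n.
rewrite -card_pair_porbits // -prod_nat_const.
have tyP C : C \in porbits (pair_perm t) ->
    (ty C == (a, b)) = (#|fst @: C| == a) && (#|snd @: C| == b).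
  case/imsetP=> -[x y] _ ->; rewrite tyE xpair_eqE fst_porbit snd_porbit.
  by rewrite -!val_eqE /= !inordK.
apply: eq_big => [C|C /andP[Cp]]; first by rewrite inE; case: (boolP (_ \in _)) => //= /tyP.
rewrite tyP // -card_fix_option ?lcmn_gt0 ?a0 //; case/imsetP: Cp => -[x y] _ ->.
by rewrite fst_porbit snd_porbit card_porbit_pair => /andP[/eqP-> /eqP->].
Qed.

Definition table := {ffun A * A -> option B}.

(** The inverse on the arguments makes this a right action, as products of permutations apply the
    left factor first. *)
Definition table_act (w : table) (g : {perm A} * {perm B}) : table :=
  [ffun p => option_perm g.2 (w (pair_perm g.1^-1 p))].

Lemma pair_permE t x y : pair_perm t (x, y) = (t x, t y).
Proof. by rewrite permE. Qed.

Lemma option_permE s o : option_perm s o = omap s o.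
Proof. by rewrite permE. Qed.

Lemma table_actE w t s x y :
  table_act w (t, s) (x, y) = omap s (w ((t^-1)%g x, (t^-1)%g y)).
Proof. by rewrite ffunE pair_permE option_permE. Qed.

Lemma table_act1 : table_act^~ 1%g =1 id.
Proof.
move=> w; apply/ffunP=> -[x y]; rewrite table_actE invg1 !perm1.
by case: (w _) => //= b; rewrite perm1.
Qed.

Lemma table_actM w : act_morph table_act w.
Proof.
move=> [t s] [t' s']; apply/ffunP=> -[x y]; rewrite !table_actE.
by rewrite invMg !permM; case: (w _) => //= b; rewrite permM.
Qed.

Definition table_action := TotalAction table_act1 table_actM.

Definition num_table_orbits := #|orbit table_action [set: {perm A} * {perm B}] @: setT|.

Lemma table_burnside :
  \sum_(t : {perm A}) \sum_(s : {perm B})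
    \prod_(1 <= a < #|A|.+1) \prod_(1 <= b < #|A|.+1)
      (1 + \sum_(d <- divisors (lcmn a b)) d * num_cycles s setT d)
        ^ (num_cycles t setT a * num_cycles t setT b * gcdn a b) =
  num_table_orbits * (#|A|`! * #|B|`!).
Proof.
transitivity (num_table_orbits * #|[set: {perm A} * {perm B}]|); last first.
  have cp (T : finType) : #|{perm T}| = #|T|`!.
    rewrite -[in RHS]cardsT -card_perm; apply: eq_card => s; rewrite inE.
    by rewrite -topredE /= /perm_on; apply/esym/subsetP=> x _; rewrite inE.
  by rewrite cardsT card_prod !cp.
rewrite /num_table_orbits -Frobenius_Cauchy; last first.
  by apply/actsP=> g _ w; rewrite !inE.
rewrite pair_big big_mkcond [RHS]big_mkcond /=; apply: eq_bigr => -[t s] _.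
rewrite inE -card_fixed_tables; apply: eq_card => w; rewrite in_setI in_setT [LHS]inE.
apply/forallP/afix1P=> [e|/ffunP e p].
  apply/ffunP=> p; rewrite ffunE /= -(eqP (e _)).
  by case: p => x y; rewrite !pair_permE !permKV.
case: p => x y; have := e (pair_perm t (x, y)).
by rewrite pair_permE /= table_actE !permK => <-; rewrite option_permE.
Qed.

End FixedTables.

(** * From sums over permutations to sums over partitions *)

Section TypeSums.
Variable n : nat.

Definition cycle_type (s : {perm 'I_n}) : mults n :=
  [ffun i : 'I_n.+1 => inord (num_cycles s setT i)].

(** Agreement is needed beyond [n] too, since divisors of lcm(a, b) may exceed it; there both sides
    vanish, no cycle being that long. *)
Lemma mult_cycle_type s : mult (cycle_type s) =1 num_cycles s setT.
Proof.
move=> i; rewrite /mult; have [i_n|n_i] := ltnP i n.+1.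
  by rewrite ffunE !inordK // ltnS (leq_trans (num_cycles_le _ _ _)) // cardsT card_ord.
symmetry; apply/eqP; rewrite cards_eq0; apply/eqP/setP=> C; rewrite !inE.
apply/negbTE; apply/negP=> /andP[_ /eqP Ci].
by move: (max_card (mem C)); rewrite card_ord leqNgt Ci n_i.
Qed.

Lemma mult_ord (j : mults n) (i : 'I_n.+1) : mult j i = j i.
Proof. by rewrite /mult ltn_ord inord_val. Qed.

Lemma is_partP (j : mults n) :
  reflect (mult j 0 = 0 /\ \sum_(i < n.+1) i * mult j i = n) (is_part j).
Proof.
rewrite /is_part -val_eqE /= -(mult_ord j ord0) /=.
have <- : \sum_(i < n.+1) i * mult j i = \sum_(i < n.+1) i * j i.
  by apply: eq_bigr => i _; rewrite mult_ord.
by apply: (iffP andP) => -[/eqP ? /eqP ?].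
Qed.

Lemma is_part_cycle_type s : is_part (cycle_type s).
Proof.
apply/is_partP; rewrite mult_cycle_type num_cycles0; split=> //.
under eq_bigr => i _ do rewrite mult_cycle_type.
by have := sum_num_cycles s; rewrite card_ord.
Qed.

Lemma card_cycle_type (j : mults n) : is_part j ->
  #|[set s | cycle_type s == j]| * \prod_(1 <= i < n.+1) ((mult j i)`! * i ^ mult j i)
  = n`!.
Proof.
case/is_partP=> j0 sj; rewrite prodn_ord_from1; last by rewrite j0.
have := @card_of_type 'I_n n (mult j) setT; rewrite cardsT card_ord => <- //.
congr (_ * _); apply: eq_card => s; rewrite !inE.
have -> : perm_on setT s by apply/subsetP=> x _; rewrite inE.
apply/eqP/forallP=> [<- i|e]; first by rewrite mult_cycle_type.
by apply/ffunP=> i; apply/val_inj; rewrite /= -!mult_ord mult_cycle_type; apply/eqP.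
Qed.

Local Open Scope ring_scope.

(** The weight is the class size. [F] is required to respect pointwise equality because [mult j] and
    [num_cycles s setT] agree only pointwise. *)
Lemma sum_cycle_type (F : (nat -> nat) -> rat) :
  (forall g g', g =1 g' -> F g = F g') ->
  \sum_(s : {perm 'I_n}) F (num_cycles s setT) =
  \sum_(j : mults n | is_part j)
    n`!%:R / \prod_(1 <= i < n.+1) ((mult j i)`! * i ^ mult j i)%N%:R * F (mult j).
Proof.
move=> Fext; rewrite (partition_big cycle_type (@is_part n)) /=; last first.
  by move=> s _; apply: is_part_cycle_type.
apply: eq_bigr => j pj.
rewrite (eq_bigr (fun=> F (mult j))); last first.
  by move=> s /eqP<-; apply: Fext => i; rewrite mult_cycle_type.
have := card_cycle_type pj; set z := (\prod_(_ <= _ < _) _)%N => zE.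
have -> : \prod_(1 <= i < n.+1) ((mult j i)`! * i ^ mult j i)%N%:R = z%:R :> rat.
  by rewrite /z natr_prod.
have z0 : z%:R != 0 :> rat.
  by rewrite pnatr_eq0; apply: contraTneq (fact_gt0 n) => z0; rewrite -zE z0 muln0.
rewrite sumr_const -zE natrM mulfK // mulr_natl; congr (_ *+ _).
by apply: eq_card => s; rewrite !inE.
Qed.

End TypeSums.

Section NfunOrbits.
Local Open Scope ring_scope.

Theorem Nfun_orbits p q : (0 < q)%N ->
  Nfun p q = (num_table_orbits 'I_(p - q) 'I_(q - 1))%:R.
Proof.
move=> q0; have qE : q = (q - 1).+1 by rewrite subn1 prednK.
(* The product over parts of [j] must end at [(q - 1).+1] to match the cycle types of
   ['I_(q - 1)]. *)
rewrite /Nfun (_ : index_iota 1 q = index_iota 1 (q - 1).+1) -?qE //.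
set u := (q - 1)%N; set t := (p - q)%N.
pose G (j k : nat -> nat) : rat :=
  \prod_(1 <= a < t.+1) \prod_(1 <= b < t.+1)
    ((1 + \sum_(d <- divisors (lcmn a b)) d * j d) ^ (k a * k b * gcdn a b))%N%:R.
have Gext j j' k k' : j =1 j' -> k =1 k' -> G j k = G j' k'.
  move=> ej ek; apply: eq_bigr => a _; apply: eq_bigr => b _.
  by rewrite !ek; congr ((1 + _) ^ _)%N%:R; apply: eq_bigr => d _; rewrite ej.
have fact_neq0 n : (n`!)%:R != 0 :> rat by rewrite pnatr_eq0 -lt0n fact_gt0.
apply: (mulIf (mulf_neq0 (fact_neq0 t) (fact_neq0 u))).
rewrite -!natrM; have := table_burnside 'I_t 'I_u; rewrite !card_ord => <-.
rewrite natr_sum.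
transitivity (\sum_(s : {perm 'I_t}) \sum_(r : {perm 'I_u})
    G (num_cycles r setT) (num_cycles s setT)); last first.
  apply: eq_bigr => s _; rewrite natr_sum; apply: eq_bigr => r _.
  by rewrite natr_prod; apply: eq_bigr => a _; rewrite natr_prod.
rewrite (@sum_cycle_type t (fun k => \sum_(r : {perm 'I_u}) G (num_cycles r setT) k)); last first.
  by move=> k k' ek; apply: eq_bigr => r _; apply: Gext.
rewrite exchange_big big_distrl; apply: eq_bigr => k _ /=.
rewrite (@sum_cycle_type u (fun j => G j (mult k))); last first.
  by move=> j j' ej; apply: Gext.
rewrite big_distrl big_distrr; apply: eq_bigr => j _ /=.
rewrite -/(G (mult j) (mult k)) invfM natrM; ring.
Qed.

End NfunOrbits.

(** * Isomorphism classes *)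

Section Classes.

(** Shaped like the set in [num_nilp3], which is therefore an instance by conversion. *)
Definition classes_in (T : finType) (E : rel T) (X : {set T}) : {set {set T}} :=
  [set [set y in X | E x y] | x in X].

Lemma leq_card_imset_factor (T U V : finType) (X : {set T}) (h : T -> U) (k : T -> V) :
  {in X &, forall x y, h x = h y -> k x = k y} -> #|k @: X| <= #|h @: X|.
Proof.
move=> hk; have [->|/set0Pn[x0 _]] := eqVneq X set0; first by rewrite imset0 cards0.
pose f u := k (odflt x0 [pick x in X | h x == u]).
apply: leq_trans (leq_imset_card f (mem (h @: X))); apply: subset_leq_card.
apply/subsetP=> _ /imsetP[x xX ->]; apply/imsetP; exists (h x); first exact: imset_f.
rewrite /f; case: pickP => [y /andP[yX /eqP yx]|/(_ x)] /=; last by rewrite xX eqxx.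
by apply: hk.
Qed.

Lemma eq_class_in (T : finType) (E : rel T) (X : {set T}) :
  reflexive E -> symmetric E -> transitive E ->
  forall x y, x \in X -> y \in X ->
  [set z in X | E x z] = [set z in X | E y z] <-> E x y.
Proof.
move=> Er Es Et x y xX yX; split=> [/setP/(_ y)|xy]; first by rewrite !inE yX Er.
apply/setP=> z; rewrite !inE; congr andb; apply/idP/idP; apply: Et => //.
by rewrite Es.
Qed.

(** [f] acts like an equivalence of groupoids: it preserves and reflects the relations and meets
    every class, without having to be a bijection. *)
Lemma card_classes_transfer (T T' : finType) (E : rel T) (E' : rel T')
    (X : {set T}) (X' : {set T'}) (f : T' -> T) :
    reflexive E -> symmetric E -> transitive E ->
    reflexive E' -> symmetric E' -> transitive E' ->
    {in X', forall w, f w \in X} ->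
    {in X' &, forall w w', E (f w) (f w') = E' w w'} ->
    {in X, forall x, exists2 w, w \in X' & E x (f w)} ->
  #|classes_in E X| = #|classes_in E' X'|.
Proof.
move=> Er Es Et Er' Es' Et' fX fE fS.
have -> : classes_in E X = [set [set y in X | E (f w) y] | w in X'].
  apply/setP=> C; apply/imsetP/imsetP=> -[x xX ->]; last by exists (f x); rewrite ?fX.
  have [w wX xw] := fS x xX; exists w => //.
  by apply/(eq_class_in Er Es Et) => //; apply: fX.
apply/eqP; rewrite eqn_leq !leq_card_imset_factor // => w w' wX wX' e.
  apply/(eq_class_in Er' Es' Et') => //; rewrite -fE //.
  exact: (eq_class_in Er Es Et (fX _ wX) (fX _ wX')).1.
apply/(eq_class_in Er Es Et); rewrite ?fX // fE //.
exact: (eq_class_in Er' Es' Et' wX wX').1.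
Qed.

(** An invariant is constant on each class, so every class lies inside a single fibre. It is applied
    to surjectivity of tables and to the size of S^2. *)
Lemma card_classes_split (T I : finType) (E : rel T) (X : {set T}) (f : T -> I) :
    reflexive E -> {in X &, forall x y, E x y -> f x = f y} ->
  #|classes_in E X| = \sum_i #|classes_in E [set x in X | f x == i]|.
Proof.
move=> Er Ef; pose h x := [set y in X | E x y].
have hi i : classes_in E [set x in X | f x == i] = h @: [set x in X | f x == i].
  apply: eq_in_imset => x; rewrite inE => /andP[xX /eqP fx]; apply/setP=> y.
  rewrite !inE andbAC; have [/andP[yX xy]|//] := boolP (_ && E x y).
  by rewrite -fx -(Ef x y) ?eqxx.
under eq_bigr => i _ do rewrite hi -sum1_card big_mkcond.
rewrite exchange_big -sum1_card big_mkcond /=; apply: eq_bigr => C _.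
case: ifPn => [/imsetP[x xX Ch]|nC]; last first.
  rewrite big1 // => i _; case: ifP => // /imsetP[x]; rewrite inE => /andP[xX _] Ch.
  by case/negP: nC; rewrite Ch imset_f.
rewrite (bigD1 (f x)) //= big1 => [|i ni]; last first.
  case: ifP => // /imsetP[y]; rewrite inE => /andP[yX /eqP fy] Ch'.
  have : x \in h y by rewrite -Ch' Ch inE xX Er.
  by rewrite inE => /andP[_ /Ef fyx]; case/eqP: ni; rewrite -fyx.
by rewrite Ch imset_f // inE xX eqxx.
Qed.

End Classes.

(** * Surjective tables up to isomorphism *)

Section TableClasses.
Variables A B : finType.
Implicit Types (w : table A B).

Definition table_iso : rel (table A B) :=
  fun w w' => w' \in orbit (table_action A B) [set: {perm A} * {perm B}] w.

Lemma table_isoP w w' :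
  reflect (exists (t : {perm A}) (s : {perm B}),
             forall x y, w' (t x, t y) = omap s (w (x, y)))
          (table_iso w w').
Proof.
apply: (iffP idP) => [/orbitP[[t s] _ <-]|[t [s e]]].
  by exists t, s => x y; rewrite /= table_actE !permK.
apply/orbitP; exists (t, s); rewrite ?inE //; apply/ffunP=> -[x y] /=.
by rewrite table_actE -e !permKV.
Qed.

Lemma table_iso_refl : reflexive table_iso.
Proof. by move=> w; apply: orbit_refl. Qed.

Lemma table_iso_sym : symmetric table_iso.
Proof. by move=> w w'; rewrite /table_iso orbit_sym. Qed.

Lemma table_iso_trans : transitive table_iso.
Proof. by move=> w2 w1 w3 w12 w23; apply: (orbit_trans w23). Qed.

Definition surj_table w := [forall b, [exists p, w p == Some b]].

Lemma surj_table_iso w w' : table_iso w w' -> surj_table w = surj_table w'.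
Proof.
have half u v : table_iso u v -> surj_table u -> surj_table v.
  case/table_isoP=> t [s e] /forallP su; apply/forallP=> b.
  have /existsP[[x y] /eqP uxy] := su (s^-1 b)%g.
  by apply/existsP; exists (t x, t y); rewrite e uxy /= permKV.
by move=> ww; apply/idP/idP; apply: half => //; rewrite table_iso_sym.
Qed.

Definition num_surj_classes := #|classes_in table_iso [set w | surj_table w]|.

Lemma num_surj_classes_eq0 : #|A| * #|A| < #|B| -> num_surj_classes = 0.
Proof.
move=> AB; rewrite /num_surj_classes (_ : [set w | _] = set0).
  by rewrite /classes_in imset0 cards0.
apply/setP=> w; rewrite !inE; apply/negbTE/negP=> /forallP sw.
move: AB; rewrite ltnNge -card_prod => /negP[].
rewrite -cardsT -(card_imset setT (f := @Some B)); last by move=> ? ? [].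
rewrite -[X in _ <= X]cardsT.
apply: leq_trans (leq_imset_card w (mem setT)); apply: subset_leq_card.
apply/subsetP=> _ /imsetP[b _ ->]; have /existsP[p /eqP <-] := sw b.
exact: imset_f.
Qed.

Lemma num_table_orbits_classes : num_table_orbits A B = #|classes_in table_iso setT|.
Proof.
rewrite /num_table_orbits /classes_in; congr #|pred_of_set _|.
by apply: eq_imset => w; apply/setP=> w'; rewrite !inE.
Qed.

End TableClasses.

Section DropPoint.
Variables (A : finType) (b : nat).

Definition embed_table (w : table A 'I_b) : table A 'I_b.+1 :=
  [ffun p => omap (lift ord_max) (w p)].

Lemma embed_table_iso w w' : table_iso (embed_table w) (embed_table w') = table_iso w w'.
Proof.
apply/table_isoP/table_isoP=> -[t [s e]]; last first.
  exists t, (lift_perm ord_max ord_max s) => x y.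
  by rewrite !ffunE e; case: (w _) => //= j; rewrite lift_perm_lift.
(* [s] need not fix the dropped point [ord_max], but [s'] does, and it agrees
   with [s] on the values of [embed_table w]. *)
pose s' := (s * tperm ord_max (s ord_max))%g.
have s'max : s' ord_max = ord_max by rewrite permM tpermR.
have s'lift j : ord_max != s' (lift ord_max j).
  by rewrite -{1}s'max (inj_eq perm_inj) neq_lift.
pose r j := odflt j (unlift ord_max (s' (lift ord_max j))).
have rE j : lift ord_max (r j) = s' (lift ord_max j).
  by rewrite /r; case: (unlift_some (s'lift j)) => k -> ->.
have rI : injective r.
  by move=> i j rij; apply: (@lift_inj _ ord_max); apply: (@perm_inj _ s'); rewrite -!rE rij.
exists t, (perm rI) => x y; have := e x y; rewrite !ffunE.
case: (w (x, y)) => [j|]; case: (w' _) => [k|] //= [] kj.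
rewrite permE; congr Some; apply: (@lift_inj _ ord_max).
by rewrite rE permM -kj tpermD ?neq_lift // kj (inj_eq perm_inj) neq_lift.
Qed.

(** Swapping a missed point [c] with [ord_max] makes [ord_max] the missed one, so [unlift] loses no
    value. *)
Lemma nonsurj_table_embed (w : table A 'I_b.+1) : ~~ surj_table w ->
  exists w', table_iso w (embed_table w').
Proof.
rewrite negb_forall => /existsP[c]; rewrite negb_exists => /forallP nc.
exists [ffun p => obind (fun j => unlift ord_max (tperm c ord_max j)) (w p)].
apply/table_isoP; exists 1%g, (tperm c ord_max) => x y; rewrite !ffunE !perm1.
have := nc (x, y); case: (w _) => //= j jc.
have : ord_max != tperm c ord_max j.
  by rewrite -{1}(tpermL c ord_max) (inj_eq perm_inj) eq_sym; apply: contra jc => /eqP->.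
by case/unlift_some => k kE ->; rewrite /= -kE.
Qed.

Lemma num_table_orbitsS :
  num_table_orbits A 'I_b.+1 = num_surj_classes A 'I_b.+1 + num_table_orbits A 'I_b.
Proof.
rewrite !num_table_orbits_classes.
rewrite (card_classes_split (f := @surj_table A 'I_b.+1)); last 2 first.
- exact: table_iso_refl.
- by move=> w w' _ _; apply: surj_table_iso.
rewrite big_bool; congr (_ + _).
  by congr #|pred_of_set (classes_in _ _)|; apply/setP=> w; rewrite !inE eqb_id.
apply: (card_classes_transfer (f := embed_table)).
- exact: table_iso_refl.
- exact: table_iso_sym.
- exact: table_iso_trans.
- exact: table_iso_refl.
- exact: table_iso_sym.
- exact: table_iso_trans.
- move=> w _; rewrite !inE eqbF_neg; apply/forallP=> /(_ ord_max)/existsP[p].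
  by rewrite ffunE; case: (w p) => //= j /eqP[e]; have := neq_bump b j; rewrite e eqxx.
- by move=> w w' _ _; apply: embed_table_iso.
move=> w; rewrite !inE eqbF_neg => /nonsurj_table_embed[w' ww].
by exists w'; rewrite ?inE.
Qed.

End DropPoint.

Section OpIso.

(** Carriers may differ, since a table lives on a sum type and a [binop] on ['I_n]. *)
Definition op_iso (T U : Type) (m : T -> T -> T) (l : U -> U -> U) :=
  exists2 f : T -> U, bijective f & forall x y, f (m x y) = l (f x) (f y).

Lemma op_iso_sym T U (m : T -> T -> T) (l : U -> U -> U) : op_iso m l -> op_iso l m.
Proof.
case=> f [g fK gK] fm; exists g; first by exists f.
by move=> x y; rewrite -{1}(gK x) -{1}(gK y) -fm fK.
Qed.

Lemma op_iso_trans T U V (m : T -> T -> T) (l : U -> U -> U) (k : V -> V -> V) :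
  op_iso m l -> op_iso l k -> op_iso m k.
Proof.
case=> f fB fm [g gB gl]; exists (g \o f); first exact: bij_comp.
by move=> x y; rewrite /= fm gl.
Qed.

Lemma sg_isoP n (s t : binop n) :
  reflect (op_iso (fun x y => s (x, y)) (fun x y => t (x, y))) (sg_iso s t).
Proof.
apply: (iffP existsP) => [[f /forallP fE]|[f fB fE]].
  exists f => [|x y]; first by exists f^-1%g; [apply: permK|apply: permKV].
  by apply/eqP/(forallP (fE x)).
exists (perm (bij_inj fB)); apply/forallP=> x; apply/forallP=> y.
by rewrite !permE fE.
Qed.

Lemma sg_iso_refl n : reflexive (@sg_iso n).
Proof. by move=> s; apply/sg_isoP; exists id => //; exists id. Qed.

Lemma sg_iso_sym n : symmetric (@sg_iso n).
Proof. by move=> s t; apply/sg_isoP/sg_isoP; apply: op_iso_sym. Qed.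

Lemma sg_iso_trans n : transitive (@sg_iso n).
Proof. by move=> s t u /sg_isoP st /sg_isoP tu; apply/sg_isoP/(op_iso_trans st). Qed.

Lemma card_sq_set_iso n (s t : binop n) : sg_iso s t -> #|sq_set s| = #|sq_set t|.
Proof.
have half (u v : binop n) : sg_iso u v -> #|sq_set u| <= #|sq_set v|.
  case/existsP=> f /forallP fE; rewrite -(card_imset (sq_set u) (@perm_inj _ f)).
  apply: subset_leq_card; apply/subsetP=> _ /imsetP[_ /imset2P[x y _ _ ->] ->].
  by rewrite (eqP (forallP (fE x) y)); apply: imset2_f.
by move=> st; apply/eqP; rewrite eqn_leq !half // sg_iso_sym.
Qed.

End OpIso.

(** * The semigroup attached to a table *)

Section TableOp.
Variables A B : finType.
Implicit Types (w : table A B).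

(* A degree-3 nilpotent semigroup with zero [inr None], nonzero products
   [inr (Some b)] and non-products [inl a]. *)
Definition table_op w (u v : A + option B) : A + option B :=
  match u, v with inl a, inl a' => inr (w (a, a')) | _, _ => inr None end.

Lemma table_op_inr w u v : exists o, table_op w u v = inr o.
Proof. by case: u v => [a|o] [a'|o'] /=; eexists. Qed.

(** With [w] surjective every [inr o] is a product, and a homomorphism sends products to
    products. *)
Lemma table_op_hom_inr w w' f : surj_table w ->
  (forall u v, f (table_op w u v) = table_op w' (f u) (f v)) ->
  forall o, exists o', f (inr o) = inr o'.
Proof.
move=> sw fE; case=> [b|].
  have /existsP[[a a'] /eqP wb] := forallP sw b.
  by have := fE (inl a) (inl a'); rewrite /= wb => ->; apply: table_op_inr.
by have := fE (inr None) (inr None) => /= ->; apply: table_op_inr.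
Qed.

Lemma table_op_isoP w w' : surj_table w -> surj_table w' ->
  reflect (op_iso (table_op w) (table_op w')) (table_iso w w').
Proof.
move=> sw sw'; apply: (iffP (table_isoP w w')) => [[t [s e]]|[f [g fK gK] fE]].
  pose F (t : {perm A}) (s : {perm B}) (u : A + option B) :=
    match u with inl a => inl (t a) | inr o => inr (omap s o) end.
  exists (F t s).
    exists (F t^-1 s^-1)%g; case=> [a|[b|]] //=; by rewrite ?permK ?permKV.
  by case=> [a|o] [a'|o'] //=; rewrite e.
have gE u v : g (table_op w' u v) = table_op w (g u) (g v).
  by rewrite -{1}(gK u) -{1}(gK v) -fE fK.
have f_inr := table_op_hom_inr sw fE.
have g_inr := table_op_hom_inr sw' gE.
(* Zero is its own square; its image is some [inr o], and the square of such an element is zero. *)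
have f0 : f (inr None) = inr None.
  have [o fo] := f_inr None; have := fE (inr None) (inr None).
  by rewrite /= fo => ->.
have f_inl a : exists a', f (inl a) = inl a'.
  case fa: (f (inl a)) => [a'|o]; first by exists a'.
  by have [o' go] := g_inr o; move: (fK (inl a)); rewrite fa go.
have f_some b : exists b', f (inr (Some b)) = inr (Some b').
  have [[b'|] fb] := f_inr (Some b); first by exists b'.
  by move: (fK (inr (Some b))); rewrite fb -f0 fK.
pose t a := if f (inl a) is inl a' then a' else a.
pose s b := if f (inr (Some b)) is inr (Some b') then b' else b.
have tE a : f (inl a) = inl (t a) by rewrite /t; have [a' ->] := f_inl a.
have sE b : f (inr (Some b)) = inr (Some (s b)).
  by rewrite /s; have [b' ->] := f_some b.
have fI := can_inj fK.
have tI : injective t by move=> x y xy; have [] : inl x = inl y :> A + option B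
  by apply: fI; rewrite !tE xy.
have sI : injective s by move=> x y xy; have [] : inr (Some x) = inr (Some y) :> A + option B
  by apply: fI; rewrite !sE xy.
exists (perm tI), (perm sI) => x y; rewrite !permE.
have := fE (inl x) (inl y); rewrite !tE /=.
by case: (w _) => [b|] /=; rewrite ?sE ?f0 ?permE => -[<-]; rewrite ?permE.
Qed.

End TableOp.

(** * Degree-3 nilpotent semigroups on ['I_n] as tables *)

Section Transport.
Variables (n t b : nat).
Hypothesis n_tb : n = t + b.+2.

(** Here |S^2| is [b.+2]: the zero [None] and [b.+1] nonzero products; [t] counts the
    non-products. *)
Let U : finType := ('I_t + option 'I_b.+1)%type.

Lemma card_table_carrier : #|{: U}| = n.
Proof. by rewrite card_sum card_option !card_ord. Qed.

Definition carrier_ord (u : U) : 'I_n := cast_ord card_table_carrier (enum_rank u).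
Definition ord_carrier (i : 'I_n) : U := enum_val (cast_ord (esym card_table_carrier) i).

Lemma carrier_ordK : cancel carrier_ord ord_carrier.
Proof. by move=> u; rewrite /ord_carrier cast_ordK enum_rankK. Qed.

Lemma ord_carrierK : cancel ord_carrier carrier_ord.
Proof. by move=> i; rewrite /carrier_ord enum_valK cast_ordKV. Qed.

Definition table_sg (w : table 'I_t 'I_b.+1) : binop n :=
  [ffun p => carrier_ord (table_op w (ord_carrier p.1) (ord_carrier p.2))].

Lemma table_sg_iso w : op_iso (table_op w) (fun x y => table_sg w (x, y)).
Proof.
exists carrier_ord; first by exists ord_carrier; [apply: carrier_ordK|apply: ord_carrierK].
by move=> x y; rewrite ffunE !carrier_ordK.
Qed.

Lemma card_sq_table_sg w : surj_table w -> #|sq_set (table_sg w)| = b.+2.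
Proof.
move=> sw; transitivity #|(fun o => carrier_ord (inr o)) @: [set: option 'I_b.+1]|.
  apply: eq_card => x; apply/imset2P/imsetP => [[y z _ _ ->]|[o _ ->]].
    rewrite ffunE /=; have [o ->] := table_op_inr w (ord_carrier y) (ord_carrier z).
    by exists o; rewrite ?in_setT.
  case: o => [c|].
    have /existsP[[a a'] /eqP wc] := forallP sw c.
    by exists (carrier_ord (inl a)) (carrier_ord (inl a')); rewrite ?ffunE ?carrier_ordK //= wc.
  by exists (carrier_ord (inr None)) (carrier_ord (inr None)); rewrite ?ffunE ?carrier_ordK.
rewrite card_imset; first by rewrite cardsT card_option card_ord.
by move=> x y /(can_inj carrier_ordK)[].
Qed.

Lemma table_sg_nilp3 w : surj_table w -> table_sg w \in nilp3_semigroups n.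
Proof.
move=> sw; have op0l x y z : table_op w (table_op w x y) z = inr None.
  by have [o ->] := table_op_inr w x y.
have op0r x y z : table_op w x (table_op w y z) = inr None.
  by have [o ->] := table_op_inr w y z; case: x.
rewrite inE /nilp3 card_sq_table_sg // andbT; apply/andP; split.
  apply/forallP=> x; apply/forallP=> y; apply/forallP=> z.
  by rewrite !ffunE /= !carrier_ordK op0l op0r.
apply/cards1P; exists (carrier_ord (inr None)); apply/setP=> x; rewrite inE.
apply/imset2P/eqP => [[p z _ _ ->]|->].
  by rewrite !ffunE /= !carrier_ordK op0l.
exists (carrier_ord (inr None), carrier_ord (inr None)) (carrier_ord (inr None)) => //.
by rewrite !ffunE /= !carrier_ordK.
Qed.

Lemma nilp3_table (s : binop n) : s \in nilp3_semigroups n -> #|sq_set s| = b.+2 ->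
  exists2 w : table 'I_t 'I_b.+1, surj_table w & op_iso (table_op w) (fun x y => s (x, y)).
Proof.
rewrite inE => /andP[/forallP assoc_s /andP[/cards1P[z cz] _]] csq.
have s3 x y v : s (s (x, y), v) = z.
  by apply/set1P; rewrite -cz; apply/imset2P; exists (x, y) v.
have sl x y : x \in sq_set s -> s (x, y) = z by case/imset2P=> ? ? _ _ ->; apply: s3.
(* [cube_set] brackets to the left, so absorption on this side goes through associativity. *)
have sr x y : y \in sq_set s -> s (x, y) = z.
  case/imset2P=> y1 y2 _ _ ->.
  by rewrite (eqP (forallP (forallP (assoc_s x) y1) y2)) s3.
have s_sq x y : s (x, y) \in sq_set s by apply: imset2_f.
have zsq : z \in sq_set s by rewrite -(s3 z z z).
have cB : #|sq_set s :\ z| = b.+1 by move: csq; rewrite (cardsD1 z) zsq => -[].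
have cA : #|~: sq_set s| = t.
  by have := cardsC (sq_set s); rewrite csq card_ord [X in _ = X]n_tb addnC => /addIn.
pose eA (i : 'I_t) : 'I_n := enum_val (cast_ord (esym cA) i).
pose eB (i : 'I_b.+1) : 'I_n := enum_val (cast_ord (esym cB) i).
have eAP i : eA i \notin sq_set s by have := enum_valP (cast_ord (esym cA) i); rewrite inE.
have eBP i : eB i \in sq_set s :\ z := enum_valP (cast_ord (esym cB) i).
have eAI : injective eA by move=> i j /enum_val_inj/cast_ord_inj.
have eBI : injective eB by move=> i j /enum_val_inj/cast_ord_inj.
have eBsurj x : x \in sq_set s -> x != z -> exists i, eB i = x.
  move=> xs xz; have xB : x \in sq_set s :\ z by rewrite !inE xz.
  exists (cast_ord cB (enum_rank_in xB x)).
  by rewrite /eB cast_ordK enum_rankK_in.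
pose f (u : U) := match u with inl i => eA i | inr None => z | inr (Some j) => eB j end.
have f_inr o : f (inr o) \in sq_set s by case: o => [j|] //=; have := eBP j; rewrite !inE => /andP[].
have fI : injective f.
  have noA i o : f (inl i) = f (inr o) -> False.
    by move=> e; have := eAP i; rewrite -[eA i]/(f (inl i)) e f_inr.
  have eBz j : eB j != z by have := eBP j; rewrite !inE => /andP[].
  case=> [i|o] [i'|o'].
  - by move/eAI->.
  - by move/noA.
  - by move/esym/noA.
  case: o o' => [j|] [j'|] //=; first by move/eBI->.
    by move=> e; have := eBz j; rewrite e eqxx.
  by move=> e; have := eBz j'; rewrite -e eqxx.
have fB : bijective f by apply: inj_card_bij fI _; rewrite card_ord card_table_carrier.
(* The pick fails exactly when the product is [z], as [eB] enumerates all other products; [None] is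
   then the right value. *)
pose w : table 'I_t 'I_b.+1 := [ffun p => [pick k | eB k == s (eA p.1, eA p.2)]].
have fE u v : f (table_op w u v) = s (f u, f v).
  case: u v => [i|o] [j|o']; rewrite /table_op; last 3 first.
  - by rewrite [RHS]sr.
  - by rewrite [RHS]sl.
  - by rewrite [RHS]sl.
  rewrite ffunE /=; case: pickP => [k /eqP//|nk] /=.
  apply/eqP/negPn/negP; rewrite eq_sym => nz.
  have [k kE] := eBsurj _ (s_sq (eA i) (eA j)) nz.
  by have := nk k; rewrite kE eqxx.
exists w; last by exists f.
apply/forallP=> c; have := eBP c; rewrite !inE => /andP[cz' /imset2P[x y _ _ cxy]].
(* Pulled back along [f], a nonzero product can only come from two elements [inl], so the table
   attains [c]. *)
have [g _ gK] := fB; rewrite -(gK x) -(gK y) -fE in cxy.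
have := @fI (inr (Some c)) _ cxy.
case: (g x) (g y) => [i|o] [j|o'] //= [] wE.
by apply/existsP; exists (i, j); rewrite -wE.
Qed.

Lemma num_sg_classes :
  #|classes_in (@sg_iso n) [set s in nilp3_semigroups n | #|sq_set s| == b.+2]| =
  num_surj_classes 'I_t 'I_b.+1.
Proof.
apply: (card_classes_transfer (f := table_sg)).
- exact: sg_iso_refl.
- exact: sg_iso_sym.
- exact: sg_iso_trans.
- exact: table_iso_refl.
- exact: table_iso_sym.
- exact: table_iso_trans.
- by move=> w; rewrite inE => sw; rewrite inE table_sg_nilp3 ?card_sq_table_sg ?eqxx.
- move=> w w'; rewrite !inE => sw sw'; apply/sg_isoP/(table_op_isoP sw sw') => h.
    apply: (op_iso_trans (table_sg_iso w)); apply: (op_iso_trans h).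
    exact/op_iso_sym/table_sg_iso.
  apply: op_iso_trans (table_sg_iso w'); apply: op_iso_trans h.
  exact/op_iso_sym/table_sg_iso.
move=> s; rewrite inE => /andP[sn /eqP sq].
have [w sw ws] := nilp3_table sn sq; exists w; rewrite ?inE //.
by apply/sg_isoP; apply: op_iso_trans (table_sg_iso w); apply: op_iso_sym.
Qed.

End Transport.

(** * The range of summation *)

Local Open Scope ring_scope.

Section ABound.
Variable n : nat.
Hypothesis n_gt0 : (0 < n)%N.

Let r : algC := sqrtC (n%:R - 3%:R / 4%:R).
Let radicand_ge : 4^-1 <= n%:R - 3%:R / 4%:R :> algC.
Proof.
rewrite lerBrDr (_ : 4^-1 + 3%:R / 4%:R = 1); last by field.
by rewrite ler1n.
Qed.
Let r2 : r ^+ 2 = n%:R - 3%:R / 4%:R. Proof. exact: sqrtCK. Qed.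
Let r_ge : 2^-1 <= r.
Proof.
have r0 : 0 <= r by rewrite sqrtC_ge0 (le_trans _ radicand_ge) // invr_ge0 ler0n.
rewrite -(@ler_pXn2r _ 2) // ?nnegrE ?invr_ge0 ?ler0n // r2.
by rewrite (_ : 2^-1 ^+ 2 = 4^-1) //; field.
Qed.
Let r_real : r \is Num.real.
Proof. by rewrite realE (le_trans _ r_ge) // invr_ge0 ler0n. Qed.

Let rad_le : n%:R - 3%:R / 4%:R <= n%:R ^+ 2 :> algC.
Proof.
apply: (@le_trans _ _ n%:R); first by rewrite gerBl divr_ge0 ?ler0n.
by rewrite expr2 -natrM ler_nat leq_pmulr.
Qed.

(** The condition is r <= t + 1/2 with t = n - m. Since r >= 1/2 it forces m <= n; squaring then
    gives n <= t^2 + t + 1, which is m <= t^2 + 1. *)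
Lemma leq_a_bound m :
  (m <= `|a_bound n|)%N = (m <= n)%N && (m <= ((n - m) * (n - m)).+1)%N.
Proof.
have r_le : r <= n%:R.
  by rewrite -(@ler_pXn2r _ 2) // ?nnegrE ?ler0n ?(le_trans _ r_ge) ?invr_ge0 ?ler0n // r2.
(* [algC] is only partially ordered, so the floor is characterised on real elements. *)
have x_real : n%:R + 2^-1 - r \is Num.real.
  by rewrite rpredB // rpredD ?realn // rpredV realn.
(* Nonnegativity lets the absolute value stand for the integer itself. *)
have a0 : 0 <= a_bound n.
  by rewrite /a_bound real_floor_ge0 // addrAC addr_ge0 ?invr_ge0 ?ler0n // subr_ge0.
rewrite -lez_nat gez0_abs // /a_bound real_floor_ge_int // -/r -pmulrn.
rewrite lerBrDr [_%:R + r]addrC -lerBrDr addrAC.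
have [mn|nm] := leqP m n; last first.
  apply/negP=> /(le_trans r_ge); rewrite lerDr subr_ge0 ler_nat => mn.
  by rewrite ltnNge mn in nm.
rewrite -natrB //; set t := (n - m)%N.
have t0 : 0 <= t%:R + 2^-1 :> algC by rewrite addr_ge0 ?invr_ge0 ?ler0n.
rewrite -(@ler_pXn2r _ 2) // ?nnegrE ?(le_trans _ r_ge) ?invr_ge0 ?ler0n // r2.
rewrite (_ : (t%:R + 2^-1) ^+ 2 = ((t * t + t).+1)%N%:R - 3%:R / 4%:R :> algC); last first.
  by rewrite -[in RHS](natr1 (t * t + t)%N) natrD natrM; field.
by rewrite lerD2r ler_nat /= -{1}(subnKC mn) -/t -addSn leq_add2r.
Qed.

End ABound.

Theorem theorem2p2 (n : nat) (hn : (1 <= n)%N) :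
  (num_nilp3 n)%:R =
  \sum_(2 <= m < `|a_bound n|%N.+1) (Nfun n m - Nfun n.-1 m.-1) :> rat.
Proof.
have an : (`|a_bound n| <= n)%N.
  by have := leq_a_bound hn `|a_bound n|; rewrite leqnn => /esym/andP[].
(* This ensures that the cut at the successor of a(n) does not fall below the lower limit 2. *)
have a1 : (0 < `|a_bound n|)%N by rewrite leq_a_bound ?hn.
pose c m := #|classes_in (@sg_iso n) [set s in nilp3_semigroups n | #|sq_set s| == m]|.
have -> : num_nilp3 n = (\sum_(m < n.+1) c m)%N.
  rewrite /num_nilp3 -[LHS]/#|classes_in (@sg_iso n) (nilp3_semigroups n)|.
  have sqn (s : binop n) : (#|sq_set s| < n.+1)%N.
    by rewrite ltnS -[X in (_ <= X)%N](card_ord n) max_card.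
  rewrite (card_classes_split (f := fun s => Ordinal (sqn s))); last 2 first.
  - exact: sg_iso_refl.
  - by move=> s t _ _ st; apply/val_inj/card_sq_set_iso.
  by apply: eq_bigr => m _; congr #|pred_of_set (classes_in _ _)|; apply/setP=> s; rewrite !inE.
have cE m : (2 <= m <= n)%N -> c m = num_surj_classes 'I_(n - m) 'I_(m - 1).
  case: m => [|[|b]] // /andP[_ bn]; rewrite /c subSS subn0.
  by apply: num_sg_classes; rewrite subnK.
have c_small m : (m < 2)%N -> c m = 0%N.
  move=> m2; rewrite /c (_ : [set s in _ | _] = set0) ?/classes_in ?imset0 ?cards0 //.
  apply/setP=> s; rewrite !inE; apply/negbTE; apply/negP=> /andP[/andP[_ /andP[_ sq]] /eqP sm].
  by rewrite sm ltnNge -ltnS m2 in sq.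
have -> : (\sum_(m < n.+1) c m = \sum_(2 <= m < `|a_bound n|.+1) c m)%N.
  rewrite -(big_mkord xpredT c) (big_cat_nat (n := 2)) //=.
  rewrite big_nat big1 ?add0n => [|m]; last by rewrite ltnS => /c_small.
  rewrite (big_cat_nat (n := `|a_bound n|.+1)) //=.
  rewrite [X in (_ + X)%N]big_nat [X in (_ + X)%N]big1 ?addn0 // => m /andP[am mn].
  rewrite cE; last by rewrite -[(m <= n)%N]ltnS mn (leq_trans _ am).
  apply: num_surj_classes_eq0; rewrite !card_ord ltnNge.
  rewrite leq_subLR add1n; apply: contraL am => mt.
  by rewrite -leqNgt leq_a_bound // -[(m <= n)%N]ltnS mn.
rewrite natr_sum big_nat [RHS]big_nat; apply: eq_bigr => -[|[|b]] // /andP[m2 mn].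
have bn : (b.+2 <= n)%N by apply: leq_trans an.
(* Lowering both arguments of N keeps their difference, so A is unchanged while B goes from [b.+1]
   points to [b]. *)
rewrite cE ?bn // !Nfun_orbits //= -subn1 -subnDA add1n !subSS !subn0.
by rewrite num_table_orbitsS natrD addrK.
Qed.
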